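(* Consider the abstract setting of meshes, refinement, discrete solutions $u_H\in\mathcal X_H$ and refinement indicators $\eta_H(T)$ described in the context, with initial mesh $\mathcal T_0$ and set of admissible meshes $\mathbb T=\mathbb T(\mathcal T_0)$. Suppose that each parent is the union of its children, i.e., whenever $\mathcal T_h=\mathrm{refine}(\mathcal T_H,\mathcal M_H)$, then $$T=\bigcup\{T'\in\mathcal T_h : T'\subseteq T\}\quad\text{for all } T\in\mathcal T_H .$$ Suppose that there are functions $S,R:\mathbb R_{\ge0}\to\mathbb R_{\ge0}$ which are continuous at $0$ with $S(0)=0=R(0)$, and a constant $0<q_{\rm red}<1$, such that for all $\mathcal T_H\in\mathbb T$ and all $\mathcal T_h\in\mathbb T(\mathcal T_H)$ there hold (stability on non-refined elements) $\ \eta_h(\mathcal T_h\cap\mathcal T_H)\le \eta_H(\mathcal T_h\cap\mathcal T_H)+S(\|u_h-u_H\|_{\mathcal X})$; (reduction on refined elements) $\ \eta_h(\mathcal T_h\setminus\mathcal T_H)^2\le q_{\rm red}\,\eta_H(\mathcal T_H\setminus\mathcal T_h)^2+R(\|u_h-u_H\|_{\mathcal X})$. Let $M:\mathbb R_{\ge0}\to\mathbb R_{\ge0}$ be continuous at $0$ with $M(0)=0$. Let $(\mathcal T_\ell)_{\ell\in\mathbb N_0}$, $(u_\ell)_{\ell\in\mathbb N_0}$, $(\eta_\ell)_{\ell\in\mathbb N_0}$ be the output of the adaptive algorithm, where the sets of marked elements $\mathcal M_\ell\subseteq\mathcal T_\ell$ satisfy, for all $\ell\in\mathbb N_0$, $$\eta_\ell(T)\le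 M\big(\eta_\ell(\mathcal M_\ell)\big)\quad\text{for all } T\in\mathcal T_\ell\setminus\mathcal M_\ell .$$ If there exists $u_\infty\in\mathcal X$ such that $\|u_\infty-u_\ell\|_{\mathcal X}\to0$ as $\ell\to\infty$, then $$\eta_\ell\to0\quad\text{as }\ell\to\infty .$$
   Context: Meshes: Let $\Omega\subset\mathbb R^d$ be a bounded domain (or a manifold in $\mathbb R^d$) with positive measure $|\Omega|>0$. A mesh $\mathcal T_H$ of $\Omega$ is a finite set of compact sets $T$ with $|T|>0$, such that $|T\cap T'|=0$ for all $T\ne T'$ in $\mathcal T_H$, and $\overline\Omega=\bigcup_{T\in\mathcal T_H}T$. Refinement: $\mathrm{refine}(\cdot)$ is a fixed refinement strategy: for each mesh $\mathcal T_H$ and each $\mathcal M_H\subseteq\mathcal T_H$ it returns a mesh $\mathcal T_h=\mathrm{refine}(\mathcal T_H,\mathcal M_H)$ such that at least the marked elements are refined, i.e., $\mathcal M_H\subseteq\mathcal T_H\setminus\mathcal T_h$. For a mesh $\mathcal T_H$, $\mathbb T(\mathcal T_H)$ is the set of all meshes obtained from $\mathcal T_H$ by finitely many (possibly zero) successive applications of $\mathrm{refine}$ with arbitrary sets of marked elements. $\mathcal T_0$ is a fixed initial mesh and $\mathbb T:=\mathbb T(\mathcal T_0)$. Discrete setting: $\mathcal X$ is a normed space. To each mesh $\mathcal T_H$ there are associated a subspace $\mathcal X_H\subseteq\mathcal X$, an element $u_H\in\mathcal X_H$ (the discrete solution), and numbers $\eta_H(T)\ge0$ for all $T\in\mathcal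 T_H$ (refinement indicators). No further relation between these objects is assumed. For $\mathcal U_H\subseteq\mathcal T_H$ write $\eta_H(\mathcal U_H):=\big(\sum_{T\in\mathcal U_H}\eta_H(T)^2\big)^{1/2}$, and $\eta_H:=\eta_H(\mathcal T_H)$. Quantities associated with $\mathcal T_h$ resp. $\mathcal T_\ell$ carry the index $h$ resp. $\ell$. Adaptive algorithm: Starting from $\mathcal T_0$, for each $\ell=0,1,2,\dots$: compute $u_\ell\in\mathcal X_\ell$; compute $\eta_\ell(T)$ for all $T\in\mathcal T_\ell$; determine a set $\mathcal M_\ell\subseteq\mathcal T_\ell$ of marked elements; set $\mathcal T_{\ell+1}:=\mathrm{refine}(\mathcal T_\ell,\mathcal M_\ell)$. *)

(* Defs.v *)
From HB Require Import structures.
From mathcomp Require Import all_boot all_order all_algebra.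
From mathcomp Require Import finmap.
From mathcomp Require Import all_classical all_reals all_analysis.

Set Implicit Arguments.
Unset Strict Implicit.
Unset Printing Implicit Defensive.

Import Order.TTheory GRing.Theory Num.Theory.
Import numFieldNormedType.Exports.

Local Open Scope classical_set_scope.
Local Open Scope ring_scope.

Section Space.
Variables (R : realType) (d : nat).
Implicit Types (A U : set 'rV[R]_d).

Definition box (a b : 'rV[R]_d) : set 'rV[R]_d :=
  [set x | forall i, a ord0 i <= x ord0 i <= b ord0 i].

Definition box_volume (a b : 'rV[R]_d) : R := \prod_i (b ord0 i - a ord0 i).

(* d-dimensional Lebesgue outer measure; it is the Lebesgue measure on all
   Lebesgue measurable sets, in particular on open and on compact sets *)
Definition lebesgue A : \bar R :=
  ereal_inf [set (\sum_(0 <= n <oo) (box_volume (ab n).1 (ab n).2)%:E)%E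
            | ab in [set ab : nat -> 'rV[R]_d * 'rV[R]_d |
                (forall n i, (ab n).1 ord0 i <= (ab n).2 ord0 i) /\
                A `<=` \bigcup_n box (ab n).1 (ab n).2]].

Definition edist2 (x y : 'rV[R]_d) : R :=
  Num.sqrt (\sum_i (x ord0 i - y ord0 i) ^+ 2).

Definition diam U : \bar R :=
  ereal_sup [set (edist2 xy.1 xy.2)%:E | xy in U `*` U].

(* the empty set has weight 0 also for k = 0 *)
Definition diam_pow (k : nat) U : \bar R :=
  if U == set0 then 0%E else (diam U ^+ k)%E.

Definition hausdorff_pre (k : nat) (delta : R) A : \bar R :=
  ereal_inf [set (\sum_(0 <= n <oo) diam_pow k (U n))%E
            | U in [set U : nat -> set 'rV[R]_d |
                (forall n, (diam (U n) <= delta%:E)%E) /\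
                A `<=` \bigcup_n U n]].

(* k-dimensional Hausdorff outer measure, without the normalising constant
   (only whether it vanishes is ever used) *)
Definition hausdorff (k : nat) A : \bar R :=
  ereal_sup [set hausdorff_pre k delta A | delta in [set delta | 0 < delta]].

Definition half_space (k : nat) : set 'rV[R]_k :=
  [set y | forall i : 'I_k, i = 0%N :> nat -> 0 <= y ord0 i].

(* k-dimensional topological manifold, possibly with boundary, in R^d: every
   point has a relatively open neighbourhood A `&` V which phi maps
   homeomorphically, with inverse psi, onto a relatively open subset of the
   half-space *)
Definition manifold (k : nat) A : Prop :=
  forall x, A x -> exists (V : set 'rV[R]_d) (W : set 'rV[R]_k)
                          (phi : 'rV[R]_d -> 'rV[R]_k) (psi : 'rV[R]_k -> 'rV[R]_d),
    let AV := A `&` V in let HW := @half_space k `&` W in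
    [/\ open V /\ V x, open W,
        {within AV, continuous phi} /\ {within HW, continuous psi},
        (forall y, AV y -> HW (phi y) /\ psi (phi y) = y)
      & (forall z, HW z -> AV (psi z) /\ phi (psi z) = z)].

Definition bounded_domain A : Prop :=
  [/\ A !=set0, open A, connected A & bounded_set A].

(* Omega is a bounded domain or a manifold in R^d, and mu is the measure |.|
   that goes with it: Lebesgue resp. surface measure *)
Definition spatial_setting (Omega : set 'rV[R]_d) (mu : set 'rV[R]_d -> \bar R) : Prop :=
  ((bounded_domain Omega /\ mu = lebesgue) \/
   (exists k, manifold k Omega /\ mu = hausdorff k)) /\
  (0 < mu Omega)%E.

Record mesh (Omega : set 'rV[R]_d) (mu : set 'rV[R]_d -> \bar R) := Mesh {
  elements :> {fset (set 'rV[R]_d)};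
  mesh_compact : forall T : set 'rV[R]_d, T \in elements -> compact T;
  mesh_pos : forall T : set 'rV[R]_d, T \in elements -> (0 < mu T)%E;
  mesh_overlap : forall T T' : set 'rV[R]_d,
    T \in elements -> T' \in elements -> T <> T' ->
    mu (T `&` T') = 0%E;
  mesh_cover : closure Omega = \bigcup_(T in [set` elements]) T }.

End Space.

Section Refinement.
Variables (R : realType) (d : nat).
Variables (Omega : set 'rV[R]_d) (mu : set 'rV[R]_d -> \bar R).
Local Notation mesh := (mesh Omega mu).

(* values refine TH MH with MH not a subset of TH are never used *)
Definition refinement_strategy (refine : mesh -> {fset (set 'rV[R]_d)} -> mesh) : Prop :=
  forall (TH : mesh) (MH : {fset (set 'rV[R]_d)}),
    (MH `<=` TH)%fset -> (MH `<=` TH `\` refine TH MH)%fset.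

Inductive refinements (refine : mesh -> {fset (set 'rV[R]_d)} -> mesh) (TH : mesh) :
    mesh -> Prop :=
| refinements_refl : refinements refine TH TH
| refinements_step (Th : mesh) (Mh : {fset (set 'rV[R]_d)}) :
    refinements refine TH Th -> (Mh `<=` Th)%fset ->
    refinements refine TH (refine Th Mh).

Definition parent_union_of_children (refine : mesh -> {fset (set 'rV[R]_d)} -> mesh) : Prop :=
  forall (TH : mesh) (MH : {fset (set 'rV[R]_d)}), (MH `<=` TH)%fset ->
  forall T : set 'rV[R]_d, T \in elements TH ->
    T = \bigcup_(T' in [set T' | T' \in elements (refine TH MH) /\ T' `<=` T]) T'.

Definition estimator (eta : mesh -> set 'rV[R]_d -> R) (TH : mesh)
    (UH : {fset (set 'rV[R]_d)}) : R :=
  Num.sqrt (\sum_(T <- UH) eta TH T ^+ 2).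

End Refinement.

(* f : R_{>=0} -> R_{>=0}, continuous at 0 with f(0) = 0; the values of f at
   negative arguments are irrelevant *)
Definition vanishing_at0 (R : realType) (f : R -> R) : Prop :=
  [/\ forall x : R, 0 <= x -> 0 <= f x,
      f @ within [set x : R | 0 <= x] (nbhs (0 : R)) --> f 0
    & f 0 = 0].

(* Main.v *)
(** Call an element of T_k persistent if it belongs to all later meshes, and let
    C_k be the set of persistent elements of T_k. A refined element never
    reappears: the later meshes contain a proper subset of it with positive
    measure. Since T_k is finite, T_k and T_l have exactly C_k in common
    for all large l, so reduction gives
      eta_l(T_l \ C_l)^2 <= eta_l(T_l \ C_k)^2
                         <= q eta_k(T_k \ C_k)^2 + R(|u_l - u_k|),
    and iterating this contraction gives eta_l(T_l \ C_l) -> 0. Marked elements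
    are not persistent, so eta_l(M_l) -> 0, and the marking criterion
    sends eta_l(T) to 0 on each of the finitely many T in a fixed C_k. *)

Require Import Defs.
From HB Require Import structures.
From mathcomp Require Import all_boot all_order all_algebra.
From mathcomp Require Import finmap.
From mathcomp Require Import all_classical all_reals all_analysis.
From mathcomp Require Import lra.

Set Implicit Arguments.
Unset Strict Implicit.
Unset Printing Implicit Defensive.

Import Order.TTheory GRing.Theory Num.Theory.
Import numFieldNormedType.Exports.

Local Open Scope classical_set_scope.
Local Open Scope ring_scope.

(** * Sums of squares over finite sets *)

Section FsetSums.
Variables (R : realType) (K : choiceType).
Implicit Types (U V : {fset K}) (f : K -> R).

Lemma sum_fset_sqr_ge0 U f : 0 <= \sum_(T <- U) f T ^+ 2.
Proof. by apply: sumr_ge0 => T _; exact: sqr_ge0. Qed.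

Lemma sum_fsetID U V f :
  \sum_(T <- U) f T = \sum_(T <- (U `&` V)%fset) f T + \sum_(T <- (U `\` V)%fset) f T.
Proof.
rewrite (big_fsetID _ (mem V)) /=; congr (_ + _); apply: eq_fbigl => T.
  by rewrite !inE.
by rewrite !inE /= andbC.
Qed.

Lemma le_sum_fset_sqr U V f : (U `<=` V)%fset ->
  \sum_(T <- U) f T ^+ 2 <= \sum_(T <- V) f T ^+ 2.
Proof.
move=> /fsetIidPr UV; rewrite (sum_fsetID V U) UV lerDl.
exact: sum_fset_sqr_ge0.
Qed.

Lemma sum_fset_sqr_le U f (b : R) : (forall T, T \in U -> 0 <= f T <= b) ->
  \sum_(T <- U) f T ^+ 2 <= b ^+ 2 *+ #|` U|.
Proof.
move=> fb; apply: (@le_trans _ _ (\sum_(T <- U) b ^+ 2)).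
  rewrite big_seq [leRHS]big_seq; apply: ler_sum => T /fb /andP[f0 fb'].
  by rewrite lerXn2r ?nnegrE // (le_trans f0).
by rewrite big_const_seq count_predT iter_addr_0.
Qed.

End FsetSums.

(** * Real sequences tending to zero *)

Lemma ge0_cvg0 (R : realType) (f : nat -> R) : (forall n, 0 <= f n) ->
  (forall eps : R, 0 < eps -> \forall n \near \oo, f n <= eps) ->
  f n @[n --> \oo] --> (0 : R).
Proof.
move=> f_ge0 f_le; apply/cvgr0Pnorm_le => eps /f_le.
by apply: filterS => n; rewrite ger0_norm.
Qed.

(** The threshold on [l] in the reduction depends on [k], so this is not a one-step recursion: each
    further factor [q] is won by passing from a sufficiently late index to still later ones. *)
Lemma contraction_cvg0 (R : realType) (a : nat -> R) (q : R) (rho : nat -> nat -> R) :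
  (forall k, 0 <= a k) -> 0 < q < 1 ->
  (forall k, \forall l \near \oo, a l <= q * a k + rho k l) ->
  (forall eps : R, 0 < eps -> \forall k \near \oo, forall l, (k <= l)%N -> rho k l <= eps) ->
  a l @[l --> \oo] --> (0 : R).
Proof.
move=> a_ge0 /andP[q_gt0 q_lt1] a_red rho_small; apply: ge0_cvg0 => // eps eps0.
have e2 : 0 < eps / 2 by lra.
(* This tolerance makes [eps / 2] the fixed point of [x -> q * x + (1 - q) * (eps / 2)], so the
   errors do not accumulate along the induction. *)
have [|N _ rhoN] := rho_small ((1 - q) * (eps / 2)); first by rewrite mulr_gt0 // subr_gt0.
have qe : 0 < q * (eps / 2) by exact: mulr_gt0.
have a_geom n : \forall l \near \oo, a l <= q ^+ n.+1 * a N + eps / 2.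
  elim: n => [|n IHn].
    near=> l; have : a l <= q * a N + rho N l by near: l; exact: a_red.
    have : rho N l <= (1 - q) * (eps / 2).
      by apply: rhoN; rewrite /= ?leqnn //; near: l; exact: nbhs_infty_ge.
    rewrite expr1; lra.
  have [k [Nk ak]] : exists k, (N <= k)%N /\ a k <= q ^+ n.+1 * a N + eps / 2.
    near \oo => k; exists k; split; near: k; first exact: nbhs_infty_ge.
    exact: IHn.
  near=> l; have : a l <= q * a k + rho k l by near: l; exact: a_red.
  have : rho k l <= (1 - q) * (eps / 2).
    by apply: rhoN => //; near: l; exact: nbhs_infty_ge.
  have : q * a k <= q * (q ^+ n.+1 * a N + eps / 2) by rewrite ler_wpM2l // ltW.
  rewrite (exprS q n.+1); move: (q ^+ n.+1) => qn; lra.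
have qn0 : q ^+ n * a N @[n --> \oo] --> (0 : R).
  rewrite -[X in _ --> X](mul0r (a N)); apply: cvgMl.
  by apply: cvg_expr; rewrite ger0_norm // ltW.
have [n _ /(_ n.+1 (leqnSn n)) qn_le] := cvgr0_norm_le _ qn0 _ e2.
near=> l.
have : a l <= q ^+ n.+1 * a N + eps / 2 by near: l; exact: a_geom.
move/le_trans; apply; move: qn_le; rewrite /= ger0_norm; first lra.
by rewrite mulr_ge0 // exprn_ge0 // ltW.
Unshelve. all: by end_near. Qed.

Lemma vanishing_at0_cvg0 (R : realType) (f : R -> R) (T : Type)
    (F : set_system T) (x : T -> R) : Filter F -> vanishing_at0 f ->
  (forall t, 0 <= x t) -> x t @[t --> F] --> (0 : R) ->
  f (x t) @[t --> F] --> (0 : R).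
Proof.
move=> FF [_ f_cvg f0] x_ge0 x_cvg; rewrite f0 in f_cvg.
apply: cvg_trans f_cvg => P /= /x_cvg xP.
by apply: (@filterS _ F FF _ _ _ xP) => t /=; apply; exact: x_ge0.
Qed.

(** * Sequences of finite sets whose dropped elements never return *)

Section MeshSequence.
Variables (R : realType) (K : choiceType) (E : nat -> {fset K}).

Definition persistent (k : nat) : {fset K} :=
  [fset T in E k | `[< forall l, (k <= l)%N -> T \in E l >]]%fset.

Lemma persistentP k T :
  reflect (forall l, (k <= l)%N -> T \in E l) (T \in persistent k).
Proof.
rewrite !inE /=; apply: (iffP andP) => [[_ /asboolP]//|Tk].
by split; [exact: Tk | exact/asboolP].
Qed.

Lemma persistent_mono k l : (k <= l)%N -> (persistent k `<=` persistent l)%fset.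
Proof.
move=> kl; apply/fsubsetP => T /persistentP Tk.
by apply/persistentP => m /(leq_trans kl)/Tk.
Qed.

Hypothesis no_return : forall k m T,
  T \in E k -> T \notin E k.+1 -> (k < m)%N -> T \notin E m.

(** Some step between [k] and [l] drops [T], and [no_return] applies to that step. *)
Lemma notin_mesh_stays k l m T :
  T \in E k -> (k <= l)%N -> T \notin E l -> (l <= m)%N -> T \notin E m.
Proof.
move=> Tk; elim: l => [|l IHl]; first by rewrite leqn0 => /eqP <-; rewrite Tk.
rewrite leq_eqVlt => /predU1P[<-|kl]; first by rewrite Tk.
have [Tl TSl lm|Tl _ lm] := boolP (T \in E l); first exact: (no_return Tl).
exact: (IHl kl Tl (ltnW lm)).
Qed.

Lemma near_fsetI_persistent k :
  \forall l \near \oo, (E l `&` E k)%fset = persistent k.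
Proof.
(* Each non-persistent [T] of [E k] gets an index [N T] at which it is missing; for any other [T]
   the implication is vacuous and 0 serves. *)
have /choice [N NP] (T : K) : exists n, T \in (E k `\` persistent k)%fset ->
    (k <= n)%N /\ T \notin E n.
  have [|] := boolP (T \in (E k `\` persistent k)%fset); last by exists 0%N.
  rewrite inE => /andP[/negP Tp _]; apply: contrapT => noN; apply: Tp.
  apply/persistentP => l kl; apply: contrapT => /negP Tl.
  by apply: noN; exists l.
(* As [E k] is finite, there is a common index from which all its non-persistent elements are gone
   for good. *)
exists (maxn k (\max_(T <- E k) N T)) => // l /=; rewrite geq_max => /andP[kl Nl].
apply/fsetP => T; rewrite in_fsetI; apply/andP/idP => [[Tl Tk]|/persistentP Tp].
  apply: contraLR (Tl) => Tp.
  have [kN TN] : (k <= N T)%N /\ T \notin E (N T) by apply: NP; rewrite in_fsetD Tp.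
  apply: (notin_mesh_stays Tk kN TN); apply: leq_trans Nl.
  exact: leq_bigmax_seq.
by rewrite !Tp.
Qed.

Variables (e : nat -> K -> R) (q : R) (rho : nat -> nat -> R).
Let sq l (U : {fset K}) : R := \sum_(T <- U) e l T ^+ 2.

Hypothesis q01 : 0 < q < 1.
Hypothesis reduction : forall k l, (k <= l)%N ->
  sq l (E l `\` E k)%fset <= q * sq k (E k `\` E l)%fset + rho k l.
Hypothesis rho_small : forall eps : R, 0 < eps ->
  \forall k \near \oo, forall l, (k <= l)%N -> rho k l <= eps.

Lemma near_sum_setD_persistent k : \forall l \near \oo,
  sq l (E l `\` persistent k)%fset
    <= q * sq k (E k `\` persistent k)%fset + rho k l.
Proof.
near=> l.
have <- : (E l `&` E k)%fset = persistent k.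
  by near: l; exact: near_fsetI_persistent.
(* Removing the intersection from [E l] or from [E k] amounts to removing the other set, so both
   sums take the form in [reduction]. *)
rewrite fsetDIr fsetDv fset0U fsetDIr fsetDv fsetU0.
by apply: reduction; near: l; exact: nbhs_infty_ge.
Unshelve. all: by end_near. Qed.

Lemma sum_nonpersistent_cvg0 :
  sq l (E l `\` persistent l)%fset @[l --> \oo] --> (0 : R).
Proof.
apply: (contraction_cvg0 (q := q) (rho := rho)) => // [k|k].
  exact: sum_fset_sqr_ge0.
near=> l; apply: (@le_trans _ _ (sq l (E l `\` persistent k)%fset)).
  apply/le_sum_fset_sqr/fsetDS/persistent_mono.
  by near: l; exact: nbhs_infty_ge.
by near: l; exact: near_sum_setD_persistent.
Unshelve. all: by end_near. Qed.

Variables (M : nat -> {fset K}) (fM : R -> R).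
Hypothesis fM0 : vanishing_at0 fM.
Hypothesis e_ge0 : forall l T, T \in E l -> 0 <= e l T.
Hypothesis M_refined : forall l, (M l `<=` E l `\` E l.+1)%fset.
Hypothesis marking : forall l T, T \in (E l `\` M l)%fset ->
  e l T <= fM (Num.sqrt (sq l (M l))).

(** Marked elements are absent from [E l.+1] and persistent ones are present, so the marked sum is
    dominated by the non-persistent one. *)
Lemma sqrt_sum_marked_cvg0 : Num.sqrt (sq l (M l)) @[l --> \oo] --> (0 : R).
Proof.
have sqrt0 := cvg_comp _ _ sum_nonpersistent_cvg0 (@sqrt_continuous R 0).
rewrite sqrtr0 in sqrt0.
apply: squeeze_cvgr (cvg_cst 0) sqrt0.
near=> l; rewrite sqrtr_ge0 /= ler_wsqrtr //.
apply/le_sum_fset_sqr/(fsubset_trans (M_refined l))/fsetDS.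
by apply/fsubsetP => T /persistentP; exact.
Unshelve. all: by end_near. Qed.

(** The mesh is split at [persistent k] with [k] fixed before [l] grows, so that the cardinality in
    the bound for the persistent part is constant. This part, the contracted sum and the
    perturbation each take a third of [eps]. *)
Lemma sum_mesh_cvg0 : sq l (E l) @[l --> \oo] --> (0 : R).
Proof.
have fM_cvg : fM (Num.sqrt (sq l (M l))) @[l --> \oo] --> (0 : R).
  by apply: vanishing_at0_cvg0 sqrt_sum_marked_cvg0 => // l; exact: sqrtr_ge0.
apply: ge0_cvg0 => [l|eps eps0]; first exact: sum_fset_sqr_ge0.
have e3 : 0 < eps / 3 by lra.
have [k [ak rhok]] : exists k, sq k (E k `\` persistent k)%fset <= eps / 3 /\
    forall l, (k <= l)%N -> rho k l <= eps / 3.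
  near \oo => k; exists k; split; last by near: k; exact: rho_small.
  apply: le_trans (ler_norm _) _; near: k.
  exact: (cvgr0_norm_le _ sum_nonpersistent_cvg0).
have C_cvg : fM (Num.sqrt (sq l (M l))) ^+ 2 *+ #|` persistent k| @[l --> \oo]
    --> (0 : R).
  have : 0 ^+ 2 *+ #|` persistent k| = 0 :> R by rewrite expr0n mul0rn.
  by move=> <-; apply: cvgMn; rewrite expr2; exact: cvgM.
near=> l.
have kl : (k <= l)%N by near: l; exact: nbhs_infty_ge.
rewrite /sq (sum_fsetID _ (persistent k)).
have : sq l (E l `&` persistent k)%fset <= eps / 3.
  apply: (@le_trans _ _ (sq l (persistent k))).
    exact/le_sum_fset_sqr/fsubsetIr.
  apply: (@le_trans _ _ (fM (Num.sqrt (sq l (M l))) ^+ 2 *+ #|` persistent k|)).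
    apply: sum_fset_sqr_le => T /persistentP Tp.
    (* An element persistent from [k] on still lies in [E l.+1], so it is not marked at [l] and the
       marking criterion bounds it. *)
    rewrite e_ge0 ?Tp //= marking // inE Tp // andbT.
    apply/negP => /(fsubsetP (M_refined l)); rewrite inE Tp //.
    exact: leqW.
  apply: le_trans (ler_norm _) _; near: l.
  exact: (cvgr0_norm_le _ C_cvg).
have : sq l (E l `\` persistent k)%fset
    <= q * sq k (E k `\` persistent k)%fset + rho k l.
  by near: l; exact: near_sum_setD_persistent.
have := rhok l kl.
have : q * sq k (E k `\` persistent k)%fset <= eps / 3.
  have /andP[_ /ltW q_le1] := q01.
  by apply: le_trans ak; rewrite ler_piMl //; exact: sum_fset_sqr_ge0.
rewrite -!/(sq _ _); lra.
Unshelve. all: by end_near. Qed.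

End MeshSequence.

(** * Refined mesh elements never reappear *)

Section Meshes.
Variables (R : realType) (d : nat).
Variables (Omega : set 'rV[R]_d) (mu : set 'rV[R]_d -> \bar R).

(** Degenerate boxes cover the empty set. Positivity of [d] provides the vanishing factor: for
    [d = 0] the volume is an empty product, equal to 1. *)
Lemma lebesgue_set0_le0 : (0 < d)%N -> (lebesgue (@set0 'rV[R]_d) <= 0)%E.
Proof.
move=> d_gt0; apply: ereal_inf_lbound; exists (fun=> (0, 0)).
  by split=> [n i|//]; rewrite /= lexx.
rewrite eseries0 // => n _ _; rewrite /box_volume /=.
by rewrite (bigD1 (Ordinal d_gt0)) //= !mxE subrr mul0r.
Qed.

Lemma hausdorff_set0_le0 k : (hausdorff k (@set0 'rV[R]_d) <= 0)%E.
Proof.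
apply: ge_ereal_sup => _ [delta _ <-]; apply: ereal_inf_lbound.
exists (fun=> set0).
  (* The diameter of the empty set is the supremum of no values, that is [-oo], and so lies below
     every [delta]. *)
  by split=> // n; rewrite /diam setX0 image_set0 ereal_sup0 leNye.
by rewrite eseries0 // => n _ _; rewrite /diam_pow eqxx.
Qed.

(** This makes mesh elements nonempty, since their measure is positive. *)
Lemma spatial_setting_set0_le0 :
  (0 < d)%N -> spatial_setting Omega mu -> (mu set0 <= 0)%E.
Proof.
move=> d_gt0 [[[_ ->]|[k [_ ->]]] _]; first exact: lebesgue_set0_le0.
exact: hausdorff_set0_le0.
Qed.

Lemma estimator_sqr (eta : mesh Omega mu -> set 'rV[R]_d -> R)
    (TH : mesh Omega mu) (U : {fset (set 'rV[R]_d)}) :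
  estimator eta TH U ^+ 2 = \sum_(T <- U) eta TH T ^+ 2.
Proof. by rewrite sqr_sqrtr // sum_fset_sqr_ge0. Qed.

Variable refine : mesh Omega mu -> {fset (set 'rV[R]_d)} -> mesh Omega mu.
Variables (T_ : nat -> mesh Omega mu) (M_ : nat -> {fset (set 'rV[R]_d)}).
Hypothesis M_sub : forall l, (M_ l `<=` T_ l)%fset.
Hypothesis T_next : forall l, T_ l.+1 = refine (T_ l) (M_ l).

Lemma refinements_le k l : (k <= l)%N -> refinements refine (T_ k) (T_ l).
Proof.
elim: l => [|l IHl]; first by rewrite leqn0 => /eqP ->; exact: refinements_refl.
rewrite leq_eqVlt => /predU1P[->|/IHl kl]; first exact: refinements_refl.
by rewrite T_next; exact: refinements_step.
Qed.

Hypothesis parents : parent_union_of_children refine.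

(** Follow the point [x]: at each refinement the current element is the union of its children, so
    one of them contains [x]. *)
Lemma exists_descendant k l (T : set 'rV[R]_d) x :
  (k <= l)%N -> T \in elements (T_ k) -> T x ->
  exists T' : set 'rV[R]_d, [/\ T' \in elements (T_ l), T' `<=` T & T' x].
Proof.
move=> + Tk Tx; elim: l => [|l IHl].
  by case: k Tk => // Tk _; exists T; split.
rewrite leq_eqVlt => /predU1P[<-|/IHl [T' [T'l T'T T'x]]]; first by exists T; split.
move: T'x; rewrite (parents (M_sub l) T'l) -T_next => -[T'' [T''l T''T'] T''x].
by exists T''; split => //; exact: subset_trans T'T.
Qed.

Hypothesis mu0 : (mu set0 <= 0)%E.

(** If [T] reappeared in [T_ m], that mesh would also contain a descendant [T2] of a proper child of
    [T]; the overlap of [T] and [T2] is [T2], of positive measure, which [mesh_overlap] forbids. *)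
Lemma mesh_no_return k m (T : set 'rV[R]_d) :
  T \in elements (T_ k) -> T \notin elements (T_ k.+1) -> (k < m)%N ->
  T \notin elements (T_ m).
Proof.
move=> Tk TSk km; apply/negP => Tm.
have /set0P[x Tx] : T != set0.
  apply/eqP => T0; have := mesh_pos Tk.
  by rewrite T0 ltNge mu0.
have [T1 [T1k T1T T1x]] := exists_descendant (leqnSn k) Tk Tx.
have [T2 [T2m T2T1 _]] := exists_descendant km T1k T1x.
(* If [T2] were [T], the child [T1] lying between them would be [T], which is not in [T_ k.+1]. *)
have TT2 : T <> T2.
  move=> TT2; move: TSk; rewrite (_ : T = T1) ?T1k //.
  by apply/seteqP; split => //; rewrite TT2.
have := mesh_overlap Tm T2m TT2; rewrite setIidr; last exact: subset_trans T1T.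
by move=> muT2; have := mesh_pos T2m; rewrite muT2 ltxx.
Qed.

End Meshes.

Theorem theorem2 (R : realType) (d : nat) (d_gt0 : (0 < d)%N)
  (Omega : set 'rV[R]_d) (mu : set 'rV[R]_d -> \bar R)
  (Omega_mu : spatial_setting Omega mu)
  (refine : mesh Omega mu -> {fset (set 'rV[R]_d)} -> mesh Omega mu)
  (refineP : refinement_strategy refine)
  (T0 : mesh Omega mu)
  (X : normedModType R)
  (XH : mesh Omega mu -> set X)
  (XH_subspace : forall TH, submod_closed (mem (XH TH)))
  (u : mesh Omega mu -> X)
  (u_in : forall TH, XH TH (u TH))
  (eta : mesh Omega mu -> set 'rV[R]_d -> R)
  (eta_ge0 : forall (TH : mesh Omega mu) (T : set 'rV[R]_d),
    T \in elements TH -> 0 <= eta TH T)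
  (parents : parent_union_of_children refine)
  (fS fR : R -> R) (q_red : R)
  (fS0 : vanishing_at0 fS) (fR0 : vanishing_at0 fR)
  (q_red01 : 0 < q_red < 1)
  (stability : forall TH Th : mesh Omega mu,
    refinements refine T0 TH -> refinements refine TH Th ->
    estimator eta Th (Th `&` TH)%fset
      <= estimator eta TH (Th `&` TH)%fset + fS `|u Th - u TH|)
  (reduction : forall TH Th : mesh Omega mu,
    refinements refine T0 TH -> refinements refine TH Th ->
    estimator eta Th (Th `\` TH)%fset ^+ 2
      <= q_red * estimator eta TH (TH `\` Th)%fset ^+ 2 + fR `|u Th - u TH|)
  (fM : R -> R) (fM0 : vanishing_at0 fM)
  (T_ : nat -> mesh Omega mu) (M_ : nat -> {fset (set 'rV[R]_d)})
  (T_0 : T_ 0%N = T0)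
  (M_sub : forall l, (M_ l `<=` T_ l)%fset)
  (T_next : forall l, T_ l.+1 = refine (T_ l) (M_ l))
  (marking : forall l (T : set 'rV[R]_d), T \in (T_ l `\` M_ l)%fset ->
    eta (T_ l) T <= fM (estimator eta (T_ l) (M_ l)))
  (u_infty : X)
  (u_cvg : `|u_infty - u (T_ l)| @[l --> \oo] --> (0 : R)) :
  estimator eta (T_ l) (T_ l) @[l --> \oo] --> (0 : R).

Proof.
pose rho k l := fR `|u (T_ l) - u (T_ k)|.
have rho_small : forall eps : R, 0 < eps ->
    \forall k \near \oo, forall l, (k <= l)%N -> rho k l <= eps.
  move=> eps eps0.
  have [_ fR_cvg fR00] := fR0; rewrite fR00 in fR_cvg.
  (* Continuity at 0 is one-sided, whence the premise [0 <= x], which norms satisfy. *)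
  have : nbhs (0 : R) [set x | 0 <= x -> `|fR x| <= eps].
    exact: (cvgr0_norm_le _ fR_cvg _ eps0).
  move=> /nbhs_ballP[delta /= delta0 fR_le].
  (* Late discrete solutions are within [delta / 2] of [u_infty], hence within [delta] of each
     other. *)
  have d2 : 0 < delta / 2 by rewrite divr_gt0.
  have [N _ uN] := cvgr0_norm_lt _ u_cvg _ d2.
  exists N => // k /= Nk l kl.
  apply: le_trans (ler_norm _) _; apply: fR_le => //=.
  rewrite /ball /= sub0r normrN normr_id.
  have := uN k Nk; have := uN l (leq_trans Nk kl); rewrite /= !normr_id => ul uk.
  apply: le_lt_trans (ler_distD u_infty _ _) _.
  by rewrite (distrC (u _)) [ltRHS]splitr ltrD.
have mu0 := spatial_setting_set0_le0 d_gt0 Omega_mu.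
have sum_cvg : \sum_(T <- T_ l) eta (T_ l) T ^+ 2 @[l --> \oo] --> (0 : R).
  apply: (@sum_mesh_cvg0 R _ (fun l => elements (T_ l)) _ (fun l => eta (T_ l))
           q_red rho _ _ _ M_ fM) => //.
  - exact: (mesh_no_return M_sub T_next parents mu0).
  - move=> k l kl; rewrite -!estimator_sqr; apply: reduction.
      by rewrite -T_0; exact: (refinements_le M_sub T_next).
    exact: (refinements_le M_sub T_next).
  - by move=> l T; exact: eta_ge0.
  - by move=> l; rewrite T_next; exact: refineP.
have := cvg_comp _ _ sum_cvg (@sqrt_continuous R 0).
by rewrite sqrtr0.
Qed.
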